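(* Let $g,h:\mathbb{R}^n\to\mathbb{R}\cup\{\infty\}$ be convex functions and consider the problem $$\min\,[g(x)-h(x)]\quad\text{subject to}\quad x\in\operatorname{dom} g. \qquad (\mathrm{P})$$ Assume that: (i) (P) has an optimal solution; (ii) $h$ is polyhedral convex; (iii) $\dim\operatorname{epi} h=n+1$; (iv) a representation $A$ of $h$ is given; (v) $g$ is closed; (vi) for every parameter $y\in\mathbb{R}^n$, the problem $$\min_{x\in\mathbb{R}^n}[g(x)-y^Tx] \qquad (\mathrm{Q}_y)$$ has an optimal solution whenever it is bounded (i.e. whenever $\inf_{x\in\mathbb{R}^n}[g(x)-y^Tx]>-\infty$). Then the following algorithm, with input the representation $A$ of $h$ and the function $g$, works correctly, i.e. its steps can be carried out and its output $\bar x$ is an optimal solution of (P): Step (1): Compute the vertices $(y^1,s^1),\dots,(y^k,s^k)$ of the polyhedron $\operatorname{epi} h^*$. Step (2): Determine $(y^*,s^* )\in\{(y^1,s^1),\dots,(y^k,s^k)\}$ such that $s^*-g^*(y^* )=\min_{i=1,\dots,k}[s^i-g^*(y^i)]$. Step (3): Compute an optimal solution $\bar x$ of (Q$_{y}$) with parameter $y=y^*$, and output $\bar x$.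
   Context: For $f:\mathbb{R}^n\to\mathbb{R}\cup\{\infty\}$, $\operatorname{dom} f=\{x\in\mathbb{R}^n\mid f(x)\ne\infty\}$, $\operatorname{epi} f=\{(x,r)\in\mathbb{R}^n\times\mathbb{R}\mid r\ge f(x)\}$, and the conjugate of $f$ is $f^*(y)=\sup_{x\in\operatorname{dom} f}[y^Tx-f(x)]$. The function $f$ is closed if $\operatorname{epi} f$ is closed, and polyhedral convex if $\operatorname{epi} f$ is a polyhedron, i.e. the solution set of finitely many linear inequalities. A matrix $A=(B,b,C,c)$ with $B\in\mathbb{R}^{m\times n}$, $b\in\mathbb{R}^m$, $C\in\mathbb{R}^{m\times k'}$, $c\in\mathbb{R}^m$ is a representation of a polyhedral convex function $f$ if $$\operatorname{epi} f=\{(x,r)\in\mathbb{R}^{n+1}\mid \exists u\in\mathbb{R}^{k'}:\ Bx+br+Cu\ge c\}.$$ Vertices are extreme points. Computing the vertices of $\operatorname{epi} h^*$ (from a representation of $h^*$ obtained from $A$) is a polyhedral projection problem and is treated as an available subroutine. An optimal solution of (P) is by definition a point $\bar x\in\operatorname{dom} g\cap\operatorname{dom} h$ such that $g(\bar x)-h(\bar x)\le g(x)-h(x)$ for all $x\in\operatorname{dom} g$ (where $g(x)-h(x)=-\infty$ if $h(x)=\infty$). *)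

(* Defs.v *)
From HB Require Import structures.
From mathcomp Require Import all_boot all_order all_algebra.
From mathcomp Require Import all_classical all_reals all_analysis.

Set Implicit Arguments.
Unset Strict Implicit.
Unset Printing Implicit Defensive.

Import Order.TTheory GRing.Theory Num.Theory.
Import numFieldNormedType.Exports.

Local Open Scope classical_set_scope.
Local Open Scope ring_scope.

(* A function R^n -> R u {oo} is a function
   f : 'cV[R]_n -> \bar R together with the hypothesis  forall x, f x != -oo.
   R^(n+1) is 'cV[R]_n * R^o with its product topology; R^o is R as a module
   over itself, so that the product is a vector space. *)

Section Defs.
Context {R : realType}.

Section ConvexGeometry.
Context {V : vectType R}.
Implicit Types S M : set V.

Definition extreme_points S : set V :=
  [set z | S z /\ forall (a b : V) (t : R), S a -> S b -> 0 < t < 1 ->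
     z = t *: a + (1 - t) *: b -> a = z /\ b = z].

Definition affine_set M : Prop :=
  forall (a b : V) (t : R), M a -> M b -> M (t *: a + (1 - t) *: b).

Definition affine_hull S : set V := smallest affine_set S.

(* The affine hull of S is a translate of a linear subspace of dimension d;
   no d works for the empty set. *)
Definition has_dim S (d : nat) : Prop :=
  exists (a : V) (U : {vspace V}),
    affine_hull S = [set a + u | u in [set` U]] /\ \dim U = d.

End ConvexGeometry.

Section Functions.
Context {n : nat}.
Implicit Types (f g h : 'cV[R]_n -> \bar R).
Implicit Types (S : set ('cV[R]_n * R^o)) (x y : 'cV[R]_n).

Definition dotv y x : R := (y^T *m x) 0 0.

Definition dom f : set 'cV[R]_n := [set x | f x != +oo%E].

Definition epi f : set ('cV[R]_n * R^o) := [set z | (f z.1 <= (z.2)%:E)%E].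

Definition convex_fun f : Prop := convex_set (epi f).

Definition closed_fun f : Prop := closed (epi f).

Definition conjugate f y : \bar R :=
  ereal_sup [set ((dotv y x)%:E - f x)%E | x in dom f].

Definition polyhedron S : Prop :=
  exists (p : nat) (D : 'M[R]_(p, n)) (d e : 'cV[R]_p),
    S = [set z | forall i, e i 0 <= (D *m z.1 + z.2 *: d) i 0].

Definition polyhedral_convex f : Prop := polyhedron (epi f).

Definition is_representation (m k : nat)
    (B : 'M[R]_(m, n)) (b : 'cV[R]_m) (C : 'M[R]_(m, k)) (c : 'cV[R]_m) f :=
  epi f = [set z | exists u : 'cV[R]_k,
                     forall i, c i 0 <= (B *m z.1 + z.2 *: b + C *m u) i 0].

(* When h x = +oo and g x is finite, (g x - h x)%E is -oo. *)
Definition optimal_P g h x : Prop :=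
  [/\ dom g x, dom h x &
      forall x', dom g x' -> (g x - h x <= g x' - h x')%E].

Definition objective_Q g y x : \bar R := (g x - (dotv y x)%:E)%E.

Definition bounded_Q g y : Prop :=
  (-oo < ereal_inf [set objective_Q g y x | x in [set: 'cV[R]_n]])%E.

Definition optimal_Q g y x : Prop :=
  forall x', (objective_Q g y x <= objective_Q g y x')%E.

Implicit Types (vs : seq ('cV[R]_n * R^o)) (v : 'cV[R]_n * R^o).

(* The steps are input-output relations: vs lists the vertices of epi (conjugate h),
   v is a chosen minimising vertex, x is the output. *)
Definition step1 h vs : Prop :=
  [set` vs] = extreme_points (epi (conjugate h)).

Definition step2 g vs v : Prop :=
  v \in vs /\ forall w, w \in vs ->
    ((v.2)%:E - conjugate g v.1 <= (w.2)%:E - conjugate g w.1)%E.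

Definition step3 g v x : Prop := optimal_Q g v.1 x.

End Functions.
End Defs.

(* Main.v *)
Require Import Defs.
From HB Require Import structures.
From mathcomp Require Import all_boot all_order all_algebra.
From mathcomp Require Import all_classical all_reals all_analysis.
From mathcomp Require Import ring lra.

Import Order.TTheory GRing.Theory Num.Theory.
Import numFieldNormedType.Exports.

Local Open Scope classical_set_scope.
Local Open Scope ring_scope.

(** Put p = min (g - h), attained at x0. If h - y^T(.) >= -s on R^n, then
    g >= h + p gives g(x) - y^T x >= p - s for all x, that is g^*(y) <= s - p:
    every point (y,s) of epi h^* has value s - g^*(y) >= p
    ([conjugate_shift]). In particular g^*(y) is finite above, so (Q_y) is
    bounded below and hence solvable ([bounded_Q_conjugate]).

    Conversely some vertex has value at most p. The function h is a
    maximum of finitely many affine functions plus the indicator of a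
    polyhedron, so an affine minorant y^T x - s of h is exact at x0
    ([exact_affine_piece]); this (y,s) maximises the linear functional
    (y,s) |-> y^T x0 - s over epi h^*. As epi h has full dimension, epi h^*
    contains no line ([conjugate_no_line]), and a linear functional that attains
    its maximum over a polyhedron without lines attains it at a vertex
    ([extreme_maximizer]). So some vertex (w,t) has w^T x0 - t = h(x0), and
    t - g^*(w) <= t - w^T x0 + g(x0) = g(x0) - h(x0) = p.

    Therefore the vertex (y,s) chosen in Step (2) has s - g^*(y) = p. If x
    solves (Q_y), then g^*(y) = y^T x - g(x), and h(x) >= y^T x - s yields
    g(x) - h(x) <= s - g^*(y) = p, which is optimality.

    That the vertices can be listed rests on two facts: epi h^* is a polyhedron
    ([polyhedron_conjugate], by the double description method applied to the
    homogenisation of epi h), and a polyhedron has finitely many extreme points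
    ([finite_extreme_points]). *)

(** * Linear functionals given as plain functions *)

Section Scalar.
Context {R : realType} {V : lmodType R} (f : V -> R) (fL : scalar f).

Lemma scalarDZ u t v : f (u + t *: v) = f u + t * f v.
Proof. by rewrite addrC fL addrC. Qed.

Lemma scalar0 : f 0 = 0.
Proof. by have := fL (-1) 0 0; rewrite scaler0 addr0 mulN1r addNr. Qed.

Lemma scalarZ t u : f (t *: u) = t * f u.
Proof. by rewrite -[t *: u]add0r scalarDZ scalar0 add0r. Qed.

Lemma scalarB u v : f (u - v) = f u - f v.
Proof. by rewrite -scaleN1r scalarDZ mulN1r. Qed.

Lemma scalarN u : f (- u) = - f u.
Proof. by rewrite -scaleN1r scalarZ mulN1r. Qed.

End Scalar.

Arguments scalarDZ {R V f}.
Arguments scalar0 {R V f}.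
Arguments scalarZ {R V f}.
Arguments scalarB {R V f}.
Arguments scalarN {R V f}.

(** * Generators of polyhedral cones *)

Section Generators.
Context {R : realType} {V : vectType R}.

(** The cone with no constraints: a basis together with its opposite
    generates it. *)
Lemma space_generators : exists G : seq V, forall phi : V -> R, scalar phi ->
  (forall w, w \in G -> phi w <= 0) -> forall z, phi z <= 0.
Proof.
pose X := vbasis {: V}.
exists (X ++ [seq - w | w <- X]) => phi phiL phiG z.
have phi0 i : phi X`_i = 0.
  have [iX|iX] := ltnP i (size X); last by rewrite nth_default ?(scalar0 phiL).
  apply/eqP; rewrite eq_le phiG ?mem_cat ?mem_nth //=.
  rewrite -oppr_le0 -(scalarN phiL) phiG// mem_cat; apply/orP; right.
  by apply: map_f; apply: mem_nth.
rewrite (coord_vbasis (memvf z)).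
elim/big_rec: _ => [|i x _ IH]; first by rewrite (scalar0 phiL).
by rewrite phiL phi0 mulr0 add0r.
Qed.

(** This is where one inequality [0 <= a] is traded for a multiplier. The
    generators with [a w < 0] bound [mu] from below by [phi w / - a w], those
    with [0 < a w] bound it from above by [- phi w / a w], and the lower bounds
    lie below the upper ones exactly because [phi] is nonpositive on the
    combinations [a w *: v - a v *: w], on which [a] vanishes. *)
Lemma separating_multiplier (G : seq V) (a phi : V -> R) :
  (forall w, w \in G -> 0 <= a w -> phi w <= 0) ->
  (forall v w, v \in G -> w \in G -> a v < 0 -> 0 < a w ->
     a w * phi v - a v * phi w <= 0) ->
  exists2 mu, 0 <= mu & forall w, w \in G -> phi w + mu * a w <= 0.
Proof.
move=> Gpos Gpair.
pose mu := \big[Order.max/0]_(v <- G | a v < 0) (phi v / - a v).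
exists mu; first exact: bigmax_ge_id.
move=> w wG; have [aw|aw|aw] := ltgtP (a w) 0; last first.
- by rewrite aw mulr0 addr0 Gpos ?aw.
- suff : mu <= - phi w / a w by rewrite ler_pdivlMr// => ?; lra.
  rewrite /mu big_seq_cond; apply: bigmax_le => [|v /andP[vG av]].
    by rewrite divr_ge0 ?oppr_ge0 ?Gpos// ltW.
  have := Gpair v w vG wG av aw.
  by rewrite ler_pdivrMr ?oppr_gt0// mulrAC ler_pdivlMr// => ?; lra.
- have : phi w / - a w <= mu by exact: (le_bigmax_seq _ w).
  by rewrite ler_pdivrMr ?oppr_gt0// => ?; lra.
Qed.

(** Minkowski's theorem for cones, in dual form: that G generates the cone is
    expressed by saying that every linear functional nonpositive on G is
    nonpositive on the cone. In this form the double description method needs no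
    conic combinations. Adding the inequality [0 <= a i] replaces G by its part in
    the half-space and by one point of the hyperplane [a i = 0] for each pair of
    generators strictly on opposite sides; a functional [phi] nonpositive on the
    new list becomes nonpositive on the old one after adding a multiple
    [mu * a i] with [0 <= mu], to which the induction hypothesis applies. *)
Lemma cone_generators (I : eqType) (a : I -> V -> R) (r : seq I) :
  (forall i, scalar (a i)) ->
  exists G : seq V, (forall w, w \in G -> forall i, i \in r -> 0 <= a i w) /\
    forall phi : V -> R, scalar phi -> (forall w, w \in G -> phi w <= 0) ->
    forall z, (forall i, i \in r -> 0 <= a i z) -> phi z <= 0.
Proof.
move=> aL; elim: r => [|i r [G [Gr GP]]].
  have [G GP] := space_generators; exists G; split=> // phi phiL phiG z _.
  exact: GP.
pose N := [seq v <- G | a i v < 0]; pose P := [seq w <- G | 0 < a i w].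
pose H := [seq a i w *: v - a i v *: w | v <- N, w <- P].
exists ([seq w <- G | 0 <= a i w] ++ H); split.
  move=> w; rewrite mem_cat => /orP[|/allpairsP[[v x] /=]].
    rewrite mem_filter => /andP[aw wG] j; rewrite inE => /predU1P[->//|jr].
    exact: Gr.
  rewrite !mem_filter => -[/andP[av vG] /andP[ax xG] ->] j.
  rewrite (scalarB (aL j)) !(scalarZ (aL j)) inE => /predU1P[->|jr]; first by lra.
  by have := Gr _ vG _ jr; have := Gr _ xG _ jr; nra.
move=> phi phiL phiG z zr.
have [||mu mu0 Gmu] := separating_multiplier G (a i) phi.
- by move=> w wG aw; rewrite phiG// mem_cat mem_filter aw wG.
- move=> v w vG wG av aw; have := phiG (a i w *: v - a i v *: w).
  rewrite (scalarB phiL) !(scalarZ phiL); apply; rewrite mem_cat; apply/orP; right.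
  by apply/allpairsP; exists (v, w); rewrite !mem_filter av aw.
have psiL : scalar (fun z => phi z + mu * a i z).
  by move=> t u v /=; rewrite phiL aL; ring.
have zr' j : j \in r -> 0 <= a j z by move=> jr; rewrite zr// inE jr orbT.
have := GP _ psiL Gmu z zr'; have := zr i (mem_head _ _).
by nra.
Qed.

End Generators.

(** * Extreme points of polyhedra *)

Section Vertices.
Context {R : realType} {V : vectType R} {I : finType}.
Context (a : I -> V -> R) (e : I -> R) (aL : forall i, scalar (a i)).

Let P : set V := [set z | forall i, e i <= a i z].

(** The ratio test of the simplex method: [t] is the longest step possible from
    [z] in the direction [u], and the constraint [j] is the one that blocks it. It
    is positive since the active constraints do not decrease along [u]. *)
Lemma ratio_test z u : P z -> ~ P (z + u) ->
    (forall i, a i z = e i -> 0 <= a i u) ->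
  exists2 t, 0 < t & P (z + t *: u) /\
    exists j, e j < a j z /\ a j (z + t *: u) = e j.
Proof.
move=> Pz /existsNP[j0 /negP]; rewrite -ltNge => j0u act.
pose F j := (a j z - e j) / - a j u.
have aD i t : a i (z + t *: u) = a i z + t * a i u by exact: scalarDZ.
have j0N : a j0 u < 0.
  by have := Pz j0; have := aD j0 1; rewrite scale1r; lra.
case: (@arg_minP _ _ _ j0 (fun i => a i u < 0) F j0N) => j jN jmin.
have ej : e j < a j z.
  rewrite lt_neqAle Pz andbT eq_sym; apply/negP => /eqP /act.
  by rewrite leNgt jN.
have F0 : 0 < F j by rewrite divr_gt0 ?subr_gt0 ?oppr_gt0.
exists (F j) => //; split.
  move=> i; rewrite aD; have [iN|iN] := ltP (a i u) 0.
    by have := jmin i iN; rewrite {2}/F ler_pdivlMr ?oppr_gt0//; lra.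
  by have := Pz i; have := mulr_ge0 (ltW F0) iN; lra.
exists j; split=> //; rewrite aD /F; field.
by rewrite lt_eqF.
Qed.

(** An extreme point is determined by its set of active constraints: if [z] and
    [w] have the same active set, then the segment from [w] to [z] can be
    prolonged beyond [z] within the polyhedron, so [z] is extreme only if
    [z = w]. *)
Lemma finite_extreme_points : finite_set (extreme_points P).
Proof.
pose act z := [set i | a i z == e i]%SET.
pose F J := xget 0 [set z | extreme_points P z /\ act z = J].
apply: (@sub_finite_set _ _ (F @` setT)); last first.
  by apply: finite_image; exact: finite_finset.
move=> w ew; exists (act w) => //.
have [[Pz ez] zw] : extreme_points P (F (act w)) /\ act (F (act w)) = act w.
  by apply: (@xgetPex _ 0 [set z | extreme_points P z /\ act z = act w]); exists w.
move: (F _) Pz ez zw => z Pz ez zw.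
have actz i : a i z = e i -> a i w = e i.
  move=> iz; have : i \in act z by rewrite inE iz.
  by rewrite zw inE => /eqP.
have Pw := ew.1.
have [t t0 Pt] : exists2 t, 0 < t & P (z + t *: (z - w)).
  (* The full step either stays inside or is cut short by the ratio test. *)
  have [PN|PN] := pselect (P (z + (z - w))); first by exists 1; rewrite ?scale1r.
  have [|t t0 [Pt _]] := ratio_test z (z - w) Pz PN; last by exists t.
  by move=> i iz; rewrite (scalarB (aL i)) iz actz// subrr.
have t1 : 1 + t != 0 by rewrite gt_eqF// ltr_wpDl.
(* z is the point of weight (1 + t)^-1 between z + t (z - w) and w. *)
have [|//|//] := ez (z + t *: (z - w)) w (1 + t)^-1 Pt Pw.
  rewrite invr_gt0 invf_lt1 ?ltr_pwDr ?ltrDl ?t0//; lra.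
have -> : 1 - (1 + t)^-1 = (1 + t)^-1 * t by field.
rewrite -scalerA -scalerDr scalerBr addrA subrK.
by rewrite -{2}[z]scale1r -scalerDl scalerA mulVf// scale1r.
Qed.

(** A maximiser [z] that is not extreme lies inside a segment of the polyhedron.
    The functional and the constraints active at [z] are constant along it, and
    since the polyhedron contains no line, moving along the segment's direction or
    against it eventually meets a new active constraint. So a maximiser with the
    fewest inactive constraints is extreme. *)
Lemma extreme_maximizer (phi : V -> R) (z0 : V) : scalar phi ->
  (forall z u, (forall t, P (z + t *: u)) -> u = 0) ->
  P z0 -> (forall z, P z -> phi z <= phi z0) ->
  exists2 z, extreme_points P z & phi z = phi z0.
Proof.
move=> phiL noline Pz0 zmax.
pose free z := #|[set i | e i < a i z]%SET|.
(* Induction on a bound m for the number of inactive constraints. *)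
suff H m z : (free z < m)%N -> P z -> phi z = phi z0 ->
    exists2 z, extreme_points P z & phi z = phi z0 by exact: (H (free z0).+1 z0).
elim: m z => // m IH z; rewrite ltnS => zm Pz phiz.
have [ez|nez] := pselect (extreme_points P z); first by exists z.
have [u [u0 phiu actu]] : exists u, [/\ u <> 0, phi u = 0 &
    forall i, a i z = e i -> a i u = 0].
  apply: contrapT => nu; apply: nez; split=> // x y t Px Py /andP[t0 t1] zE.
  have zD f : scalar f -> f z = t * f x + (1 - t) * f y.
    by move=> fL; rewrite zE fL scalarZ.
  suff xy : x = y by rewrite zE xy -scalerDl addrC subrK scale1r.
  apply: contrapT => xy; apply: nu; exists (x - y); split.
  - by move/eqP; rewrite subr_eq0 => /eqP.
  - have := zmax x Px; have := zmax y Py; have := zD _ phiL.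
    by rewrite (scalarB phiL) phiz; nra.
  - move=> i iz; have := Px i; have := Py i; have := zD _ (aL i).
    by rewrite (scalarB (aL i)) iz; nra.
have [t Pt] : exists t, ~ P (z + t *: u).
  by apply/existsNP => Pt; apply: u0; exact: noline Pt.
have actt i : a i z = e i -> a i (t *: u) = 0.
  by move=> /actu iu; rewrite (scalarZ (aL i)) iu mulr0.
have [|s s0 [Ps [j [jz js]]]] := ratio_test z _ Pz Pt.
  by move=> i /actt ->.
apply: (IH (z + s *: (t *: u))) => //; last first.
  by rewrite (scalarDZ phiL) (scalarZ phiL) phiu !mulr0 addr0.
apply: leq_trans zm; apply: proper_card; apply/properP; split.
  apply/fintype.subsetP => i; rewrite !inE => si; rewrite lt_neqAle Pz andbT.
  apply/eqP => /esym iz; move: si.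
  by rewrite (scalarDZ (aL i)) actt// mulr0 addr0 iz ltxx.
by exists j; rewrite !inE ?js ?ltxx.
Qed.

End Vertices.
(** * Epigraphs of conjugate functions *)

Section Conjugate.
Context {R : realType} {n : nat}.
Implicit Types (f g h : 'cV[R]_n -> \bar R) (x y : 'cV[R]_n).
Implicit Types (v w z : 'cV[R]_n * R^o).

Lemma dotvE y x : dotv y x = \sum_i y i 0 * x i 0.
Proof. by rewrite /dotv mxE; apply: eq_bigr => i _; rewrite mxE. Qed.

Lemma dotvC y x : dotv y x = dotv x y.
Proof. by rewrite !dotvE; apply: eq_bigr => i _; rewrite mulrC. Qed.

Lemma dotv_scalar y : scalar (dotv y).
Proof. by move=> t u x; rewrite /dotv mulmxDr -scalemxAr !mxE. Qed.

Lemma dotv_eq0 y : dotv y y = 0 -> y = 0.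
Proof.
rewrite dotvE => /eqP; rewrite psumr_eq0 => [/allP y0|i _]; last first.
  by rewrite -expr2 sqr_ge0.
apply/matrixP => i j; rewrite (ord1 j) mxE.
by have := y0 i (mem_index_enum _); rewrite mulf_eq0 orbb => /eqP.
Qed.

Lemma polyhedron_row_scalar (p : nat) (D : 'M[R]_(p, n)) (d : 'cV[R]_p) i :
  scalar (fun z => (D *m z.1 + z.2 *: d) i 0).
Proof.
move=> t u z /=; rewrite mulmxDr -scalemxAr !mxE.
rewrite -[(t *: u.2 + z.2)]/(t * u.2 + z.2).
ring.
Qed.

Lemma dom_fin_num f x : f x != -oo%E -> dom f x -> exists q : R, f x = q%:E.
Proof. by rewrite /dom /=; case: (f x) => // q _ _; exists q. Qed.

Lemma epi_conjugate f : (forall x, f x != -oo%E) ->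
  epi (conjugate f) =
    [set v | forall z, epi f z -> dotv v.1 z.1 - z.2 <= v.2].
Proof.
move=> fNy; apply/seteqP; split=> v; rewrite /epi /conjugate /=.
  move=> vf z zf; have zd : dom f z.1.
    by rewrite /dom /=; apply: contraTneq zf => ->.
  have [q fq] := dom_fin_num f z.1 (fNy _) zd.
  have : ((dotv v.1 z.1)%:E - f z.1 <= (v.2)%:E)%E.
    by apply: le_trans vf; apply: ereal_sup_ubound; exists z.1.
  move: zf; rewrite fq -EFinB !lee_fin; lra.
move=> vf; apply: ge_ereal_sup => _ [x xd <-].
have [q fq] := dom_fin_num f x (fNy _) xd.
have := vf (x, q); rewrite fq /= lexx => /(_ isT).
by rewrite -EFinB lee_fin.
Qed.

(** Full dimension enters only through this: a set of full dimension lies in no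
    proper affine subset. *)
Lemma has_dim_full (S M : set ('cV[R]_n * R^o)) :
  has_dim S n.+1 -> affine_set M -> S `<=` M -> M = setT.
Proof.
move=> [a [U [SU dimU]]] Maff SM; apply/seteqP; split=> // z _.
suff : affine_hull S z by exact: smallest_sub.
have -> : affine_hull S = setT; last by [].
have UT : U = fullv.
  by apply/eqP; rewrite eqEdim subvf dimvf dimU;
    change (n * 1 + 1 <= n.+1)%N; rewrite muln1 addn1.
rewrite SU; apply/seteqP; split=> // x _.
by exists (x - a); [rewrite /= UT memvf|rewrite addrC subrK].
Qed.

(** If epi h^* contains a line with direction (u, s), then every affine minorant
    on that line is below h on dom h, which forces u^T x = s for all x in dom h.
    So epi h lies in the affine set u^T x = s, which is everything by full
    dimension, and then u = 0 and s = 0. *)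
Lemma conjugate_no_line h (x0 : 'cV[R]_n) :
  (forall x, h x != -oo%E) -> has_dim (epi h) n.+1 -> dom h x0 ->
  forall v u, (forall t : R, epi (conjugate h) (v + t *: u)) -> u = 0.
Proof.
move=> hNy hdim x0d v u line.
pose f (z : 'cV[R]_n * R^o) : R := dotv u.1 z.1 - u.2.
have f0 : [set z | f z = 0] = setT.
  apply: has_dim_full hdim _ _ => [a b t|z hz] /=; rewrite /f.
    rewrite !dotv_scalar (scalarZ (dotv_scalar _)) => fa fb.
    by have -> : dotv u.1 a.1 = u.2; [lra|have -> : dotv u.1 b.1 = u.2; lra].
  have line' t : dotv v.1 z.1 - z.2 - v.2 + t * (dotv u.1 z.1 - u.2) <= 0.
    have := line t; rewrite epi_conjugate//= => /(_ z hz).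
    rewrite dotvC (scalarDZ (dotv_scalar _)) ![dotv z.1 _]dotvC.
    rewrite -[(v.2 + t *: u.2)]/(v.2 + t * u.2); lra.
  apply/eqP/negPn/negP => D0.
  (* The parameter at which the left-hand side of line' equals 1. *)
  have := line' ((1 - (dotv v.1 z.1 - z.2 - v.2)) / (dotv u.1 z.1 - u.2)).
  rewrite divfK//; lra.
have {f0} fz z : f z = 0 by rewrite -[_ = _]/([set z | f z = 0] z) f0.
have u20 : u.2 = 0.
  by have := fz (0, 0); rewrite /f /= (scalar0 (dotv_scalar _)); lra.
have u10 : u.1 = 0 by apply: dotv_eq0; have := fz (u.1, 0); rewrite /f u20 /= subr0.
by rewrite [u]surjective_pairing u10 u20.
Qed.

(** The inequalities of epi h^* are indexed by the points of epi h; to keep only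
    finitely many, homogenise epi h to the cone of all (x, r, t) with
    D x + r d - t e >= 0 and t >= 0, and keep one inequality
    y^T x - r - s t <= 0 for each generator (x, r, t). Generators with t > 0 are
    multiples of points of epi h; the others, which are recession directions, are
    limits of such multiples. *)
Lemma polyhedron_conjugate h (z0 : 'cV[R]_n * R^o) :
  (forall x, h x != -oo%E) -> polyhedral_convex h -> epi h z0 ->
  polyhedron (epi (conjugate h)).
Proof.
move=> hNy [p [D [d [e hE]]]] hz0.
pose a (i : option 'I_p) (z : 'cV[R]_n * R^o * R^o) : R :=
  if i is Some j then (D *m z.1.1 + z.1.2 *: d) j 0 - z.2 * e j 0 else z.2.
have aL i : scalar (a i).
  move=> t u z; case: i => [i|] //=.
  rewrite (polyhedron_row_scalar _ D d i t u.1 z.1).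
  rewrite -[(t *: u.2 + z.2)]/(t * u.2 + z.2); ring.
have [G [Ga GP]] := cone_generators _ a (enum {: option 'I_p}) aL.
exists (size G), (\matrix_(j < size G) (- ((G`_j).1.1)^T)),
  (\col_(j < size G) ((G`_j).2 : R)), (\col_(j < size G) (- ((G`_j).1.2 : R))).
pose phi v (z : 'cV[R]_n * R^o * R^o) : R := dotv v.1 z.1.1 - z.1.2 - v.2 * z.2.
have phiL v : scalar (phi v).
  move=> t u z; rewrite /phi dotv_scalar.
  rewrite -[(t *: u + z).1.2]/(t * u.1.2 + z.1.2).
  rewrite -[(t *: u + z).2]/(t * u.2 + z.2) /=; ring.
have rowE v j : (\matrix_(j < size G) (- ((G`_j).1.1)^T) *m v.1 +
    v.2 *: \col_(j < size G) ((G`_j).2 : R)) j 0 - (\col_(j < size G)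
    (- ((G`_j).1.2 : R))) j 0 = - phi v G`_j.
  rewrite /phi dotvE !mxE.
  under eq_bigr do rewrite !mxE mulNr mulrC.
  by rewrite sumrN; ring.
have hP z : epi h z <-> forall i, e i 0 <= (D *m z.1 + z.2 *: d) i 0.
  by rewrite hE.
clear hE; rewrite epi_conjugate//; apply/seteqP; split=> v /= vP.
  move=> j; rewrite -subr_ge0 rowE oppr_ge0.
  have := mem_nth 0 (ltn_ord j); move: (G`_j) => w wG.
  (* By homogeneity the inequality holds at the points of the cone with a
     positive last coordinate; adding a small multiple of the point z1 above z0
     brings the generator w there. *)
  have {wG} wK i : 0 <= a i w by rewrite Ga// mem_enum.
  have phi_pos (u : 'cV[R]_n * R^o * R^o) : 0 < u.2 ->
      (forall i, 0 <= a i u) -> phi v u <= 0.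
    move=> u0 uK; have hu : epi h (u.2^-1 *: u.1).
      apply/hP => i; rewrite (scalarZ (polyhedron_row_scalar _ D d i)) /=.
      by rewrite ler_pdivlMl// -subr_ge0; exact: (uK (Some i)).
    have := vP _ hu; rewrite /phi (scalarZ (dotv_scalar _)).
    rewrite -[(u.2^-1 *: u.1).2]/(u.2^-1 * u.1.2) -mulrBr ler_pdivrMl//; lra.
  pose z1 : 'cV[R]_n * R^o * R^o := (z0, 1).
  have c0 : phi v z1 <= 0 by have := vP _ hz0; rewrite /phi /z1 /= mulr1; lra.
  rewrite leNgt; apply/negP => w0.
  (* With this step the sum phi v w + t * phi v z1 equals t, hence positive. *)
  pose t := phi v w / (1 - phi v z1).
  have t0 : 0 < t by rewrite divr_gt0//; lra.
  have : phi v (w + t *: z1) <= 0.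
    apply: phi_pos => [|i]; first exact: (ltr_wpDl (wK None) (mulr_gt0 t0 ltr01)).
    rewrite (scalarDZ (aL i)) addr_ge0// mulr_ge0 ?(ltW t0)//.
    by case: i => [i|] //=; rewrite mul1r subr_ge0; move/hP: hz0.
  rewrite (scalarDZ (phiL v)).
  have -> : phi v w = t * (1 - phi v z1) by rewrite /t divfK//; lra.
  lra.
move=> z /hP hz.
suff : phi v (z, 1) <= 0 by rewrite /phi /= mulr1; lra.
apply: GP => // [w /(nthP 0)[j jG <-]|[i|] _] //=; last first.
  by rewrite mul1r subr_ge0.
by have := vP (Ordinal jG); rewrite -subr_ge0 rowE oppr_ge0.
Qed.

(** Some constraint of epi h is active at (x, h x) and has a positive coefficient
    on the last coordinate, since otherwise the ratio test would allow (x, h x) to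
    move down inside epi h. Solved for the last coordinate, this constraint is an
    affine minorant of h that is exact at x. *)
Lemma exact_affine_piece h x q : polyhedral_convex h -> h x = q%:E ->
  (forall x, h x != -oo%E) ->
  exists2 v, epi (conjugate h) v & dotv v.1 x - v.2 = q.
Proof.
move=> [p [D [d [e hE]]]] hx hNy.
pose a i (z : 'cV[R]_n * R^o) := (D *m z.1 + z.2 *: d) i 0.
have hxE r : epi h (x, r) <-> q <= r.
  by rewrite /epi /= hx lee_fin.
have eE i z : epi h z -> e i 0 <= a i z by rewrite hE.
have PE z : epi h z <-> forall i, e i 0 <= a i z by rewrite hE.
clear hE; have [i [ie id]] : exists i, a i (x, q) = e i 0 /\ 0 < d i 0.
  apply: contrapT => nd.
  have aL i : scalar (a i) by exact: polyhedron_row_scalar.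
  have down t : (x, q) + t *: (0, -1) = (x, q - t) :> 'cV[R]_n * R^o.
    by congr pair; rewrite /= ?scaler0 ?addr0// -[t *: -1]/(t * -1) mulrN1.
  have [||i ie|t t0 []] := ratio_test a (fun i => e i 0) aL (x, q) (0, -1).
  - by apply/PE/hxE.
  - by rewrite -[_ + _]/((x, q) + (0, -1)) -[(0, -1)]scale1r down => /PE/hxE; lra.
  - rewrite leNgt; apply/negP => ai; apply: nd; exists i; split=> //.
    by move: ai; rewrite /a mulmx0 !mxE /=; lra.
  - by rewrite down => /PE/hxE; lra.
pose y : 'cV[R]_n := \col_l (- (D i l / d i 0)).
have aE z : a i z = d i 0 * (z.2 - dotv y z.1).
  rewrite /a dotvE !mxE mulrBr mulr_sumr addrC [z.2 * _]mulrC -sumrN; congr (_ + _).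
  by apply: eq_bigr => l _; rewrite !mxE; field; rewrite gt_eqF.
exists (y, dotv y x - q) => /=; last by lra.
rewrite epi_conjugate//= => z /(eE i); rewrite -ie !aE ler_pM2l//=; lra.
Qed.

(** By duality h x is the maximum of v.1^T x - v.2 over v in epi h^*; the maximum
    is attained at an affine piece of h, hence also at a vertex. *)
Lemma exact_vertex h x q : (forall x, h x != -oo%E) -> polyhedral_convex h ->
  has_dim (epi h) n.+1 -> h x = q%:E ->
  exists2 v, extreme_points (epi (conjugate h)) v & dotv v.1 x - v.2 = q.
Proof.
move=> hNy hpoly hdim hx.
have hxe : epi h (x, q) by rewrite /epi /= hx.
have [p [D [d [e PE]]]] := polyhedron_conjugate h (x, q) hNy hpoly hxe.
have [v0 v0P v0q] := exact_affine_piece h x q hpoly hx hNy.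
have noline := conjugate_no_line h x hNy hdim _.
have valL : scalar (fun v : 'cV[R]_n * R^o => dotv v.1 x - v.2).
  move=> t u v; rewrite -[(t *: u + v).2]/(t * u.2 + v.2) /=.
  by rewrite dotvC dotv_scalar ![dotv x _]dotvC; ring.
have val_le v : epi (conjugate h) v -> dotv v.1 x - v.2 <= q.
  by rewrite epi_conjugate// => /(_ _ hxe) /=; lra.
move: v0P noline val_le; rewrite PE => v0P noline val_le.
rewrite -v0q; apply: (extreme_maximizer (fun i z => (D *m z.1 + z.2 *: d) i 0))
  => //.
- by move=> i; exact: polyhedron_row_scalar.
- by apply: noline; rewrite /dom /= hx.
- by rewrite v0q.
Qed.

Lemma finite_vertices h z0 : (forall x, h x != -oo%E) -> polyhedral_convex h ->
  epi h z0 -> exists vs, step1 h vs.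
Proof.
move=> hNy hpoly hz0.
have [p [D [d [e PE]]]] := polyhedron_conjugate h z0 hNy hpoly hz0.
have /finite_seqP[vs vsE] : finite_set (extreme_points (epi (conjugate h))).
  rewrite PE; apply: (finite_extreme_points (fun i z => (D *m z.1 + z.2 *: d) i 0)).
  by move=> i; exact: polyhedron_row_scalar.
by exists vs; rewrite /step1 vsE.
Qed.

(** * Duality between (P) and (Q) *)

(** Weak duality: an affine minorant of h, raised by a lower bound [p] of
    [g - h], is an affine minorant of g. *)
Lemma conjugate_shift g h p v : (forall x, g x != -oo%E) ->
  (forall x, h x != -oo%E) ->
  (forall x, dom g x -> (p%:E <= g x - h x)%E) ->
  epi (conjugate h) v -> epi (conjugate g) (v.1, v.2 - p).
Proof.
move=> gNy hNy gh; rewrite !epi_conjugate// => hv z gz /=.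
have zd : dom g z.1 by rewrite /dom /=; apply: contraTneq gz; rewrite /epi /= => ->.
have := gh _ zd; move: gz; rewrite /epi /=.
have [q ->] := dom_fin_num g z.1 (gNy _) zd.
case hz: (h z.1) (hNy z.1) => [r| |]//= _.
have := hv (z.1, r); rewrite /epi /= hz lexx => /(_ isT).
by rewrite -EFinB !lee_fin; lra.
Qed.

Lemma bounded_Q_conjugate g v : (forall x, g x != -oo%E) ->
  epi (conjugate g) v -> bounded_Q g v.1.
Proof.
move=> gNy; rewrite epi_conjugate// => gv; rewrite /bounded_Q.
apply: (@lt_le_trans _ _ (- v.2)%:E); first exact: ltNyr.
apply: le_ereal_inf_tmp => _ [x _ <-]; rewrite /objective_Q.
case gx: (g x) (gNy x) => [r| |]//= _; last by rewrite leey.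
have := gv (x, r); rewrite /epi /= gx lexx => /(_ isT).
by rewrite -EFinB lee_fin; lra.
Qed.

Lemma step2_exists g vs : vs != [::] -> exists v, step2 g vs v.
Proof.
case: vs => // v0 vs _.
pose F (i : 'I_(size vs).+1) := let w := (v0 :: vs)`_i in
  ((w.2)%:E - conjugate g w.1)%E.
case: (@arg_minP _ _ _ ord0 predT F isT) => i _ imin.
exists (v0 :: vs)`_i; split; first by rewrite mem_nth.
by move=> w /(nthP 0)[j js <-]; exact: (imin (Ordinal js)).
Qed.

End Conjugate.

(** * Correctness of the algorithm *)

Theorem theorem22 (R : realType) (n : nat) (g h : 'cV[R]_n -> \bar R)
    (g_gtNy : forall x, g x != -oo%E) (h_gtNy : forall x, h x != -oo%E)
    (g_convex : convex_fun g) (h_convex : convex_fun h)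
    (P_solvable : exists x, optimal_P g h x)
    (h_polyhedral : polyhedral_convex h)
    (h_dim : has_dim (epi h) n.+1)
    (m k : nat) (B : 'M[R]_(m, n)) (b : 'cV[R]_m)
    (C : 'M[R]_(m, k)) (c : 'cV[R]_m)
    (h_repr : is_representation B b C c h)
    (g_closed : closed_fun g)
    (Q_solvable : forall y, bounded_Q g y -> exists x, optimal_Q g y x) :
  [/\ polyhedron (epi (conjugate h)),
      exists vs, step1 h vs,
      forall vs, step1 h vs -> exists v, step2 g vs v,
      forall vs v, step1 h vs -> step2 g vs v -> exists x, step3 g v x &
      forall vs v x, step1 h vs -> step2 g vs v -> step3 g v x ->
        optimal_P g h x].
Proof.
have [x0 [gx0 hx0 x0_opt]] := P_solvable.
have [q0 gq0] := dom_fin_num g x0 (g_gtNy _) gx0.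
have [r0 hr0] := dom_fin_num h x0 (h_gtNy _) hx0.
have hz0 : epi h (x0, r0) by rewrite /epi /= hr0.
have p_le x : dom g x -> ((q0 - r0)%:E <= g x - h x)%E.
  by move/x0_opt; rewrite gq0 hr0.
have g_bound v : epi (conjugate h) v -> epi (conjugate g) (v.1, v.2 - (q0 - r0)).
  exact: conjugate_shift.
have vertexP vs v : step1 h vs -> v \in vs <-> extreme_points (epi (conjugate h)) v.
  by move=> <-.
have [w wext wr0] := exact_vertex h x0 r0 h_gtNy h_polyhedral h_dim hr0.
split.
- exact: polyhedron_conjugate hz0.
- exact: finite_vertices hz0.
- move=> vs vsE; apply: step2_exists.
  by move/(vertexP _ _ vsE): wext; case: (vs).
- move=> vs v vsE [/(vertexP _ _ vsE)[/g_bound vg _] _].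
  exact/Q_solvable/(bounded_Q_conjugate _ _ g_gtNy vg).
move=> vs v x vsE [/(vertexP _ _ vsE)[vh _] vmin] x_opt.
have gx : dom g x.
  apply/eqP => gx; have := x_opt x0.
  by rewrite /objective_Q gx gq0.
have [q gq] := dom_fin_num g x (g_gtNy _) gx.
(* Optimality of x for (Q) computes the conjugate of g at v.1. *)
have gv : (conjugate g v.1 <= (dotv v.1 x - q)%:E)%E.
  apply: ge_ereal_sup => _ [x' x'd <-]; have := x_opt x'; rewrite /objective_Q gq.
  have [q' ->] := dom_fin_num g x' (g_gtNy _) x'd.
  by rewrite -!EFinB !lee_fin; lra.
have gw : ((dotv w.1 x0 - q0)%:E <= conjugate g w.1)%E.
  by apply: ereal_sup_ubound; exists x0 => //; rewrite gq0.
(* The exact vertex w witnesses that the minimum of Step (2) is at most p. *)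
have value_le : v.2 - (dotv v.1 x - q) <= q0 - r0.
  rewrite -lee_fin; apply: (@le_trans _ _ ((v.2)%:E - conjugate g v.1)%E).
    by rewrite EFinB leeB.
  apply: le_trans (vmin w _) _; first exact/(vertexP _ _ vsE).
  apply: (@le_trans _ _ ((w.2)%:E - (dotv w.1 x0 - q0)%:E)%E); first exact: leeB.
  by rewrite -EFinB lee_fin; lra.
have := p_le x gx; rewrite gq; case hx: (h x) (h_gtNy x) => [r| |]//= _ _.
have vx : dotv v.1 x - r <= v.2.
  move: vh; rewrite epi_conjugate// => vh.
  by apply: (vh (x, r)); rewrite /epi /= hx.
split; [exact: gx|by rewrite /dom /= hx|move=> x' /p_le].
apply: le_trans; rewrite gq hx -EFinB lee_fin; lra.
Qed.
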